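(* Let $\mathbb{F}$ be a field and let $\mathfrak{f}$ be the standard filiform Lie algebra over $\mathbb{F}$. A finite subset $X$ of an arbitrary group $(G,\ast)$ is arithmetically-free if and only if $\mathfrak{f}$ admits no grading by $G$ whose support is contained in $X$.
   Context: The standard filiform Lie algebra $\mathfrak{f}$ over $\mathbb{F}$ is the (infinite-dimensional) Lie algebra with basis $v,w_1,w_2,w_3,\dots$ and brackets $[v,w_i]=w_{i+1}$, $[w_j,w_k]=0$ for all $i,j,k\in\mathbb{N}=\{1,2,\dots\}$. A grading of a Lie algebra $L$ by a group $(G,\ast)$ is a decomposition $L=\bigoplus_{g\in G}L_g$ into subspaces with $[L_g,L_h]\subseteq L_{g\ast h}$ for all $g,h\in G$; its support is $\{g\in G : L_g\neq\{0\}\}$. Arithmetically-free: a subset $X$ of an abelian group $(G,+)$ is arithmetically-free iff $X$ is finite and for all $x,g\in X$ the set $\mathcal{O}(x,g)=\{x,x+g,x+2g,\dots\}$ is not contained in $X$. A subset $X$ of an arbitrary group $(G,\ast)$ is arithmetically-free iff $X$ is finite and every subset $Z$ of $X$ consisting of pairwise commuting elements is an arithmetically-free subset of the abelian subgroup generated by $Z$ (that is, for all $x,g\in Z$ the set $\{x,\,x\ast g,\,x\ast g\ast g,\,\dots\}$ is not contained in $Z$). *)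

(* Defs.v *)
From HB Require Import structures.
From mathcomp Require Import all_boot all_order all_algebra.
From mathcomp Require Import sesquilinear finmap ring.
From mathcomp Require Import classical_sets cardinality.

Set Implicit Arguments.
Unset Strict Implicit.
Unset Printing Implicit Defensive.

Import GRing.Theory.

Local Open Scope classical_set_scope.
Local Open Scope ring_scope.

(* The alternating law is stated as [x, x] = 0, so that it is the right one
   in characteristic 2 as well. *)
HB.mixin Record isLieAlgebra (F : fieldType) L of GRing.Lmodule F L := {
  bracket : L -> L -> L;
  bracket_bilinear : bilinear_for *:%R *:%R bracket;
  bracket_alternating : forall x, bracket x x = 0;
  bracket_jacobi : forall x y z,
    bracket x (bracket y z) + bracket y (bracket z x)
      + bracket z (bracket x y) = 0
}.

#[short(type="lieAlgType")]
HB.structure Definition LieAlgebra (F : fieldType) :=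
  {L of GRing.Lmodule F L & isLieAlgebra F L}.

Section Basis.
Variables (F : fieldType) (L : lmodType F) (I : choiceType).

Definition is_free (b : I -> L) : Prop :=
  forall (s : {fset I}) (a : I -> F),
    \sum_(i <- s) a i *: b i = 0 -> forall i, i \in s -> a i = 0.

Definition is_spanning (b : I -> L) : Prop :=
  forall u, exists (s : {fset I}) (a : I -> F), u = \sum_(i <- s) a i *: b i.

Definition is_basis (b : I -> L) : Prop := is_free b /\ is_spanning b.

End Basis.

(* Indices are shifted by one: [w i] is the basis vector w_(i+1). The basis
   (v, w_1, w_2, ...) is the family [oapp w v] indexed by [option nat]. *)
Definition is_standard_filiform (F : fieldType) (L : lieAlgType F)
    (v : L) (w : nat -> L) : Prop :=
  [/\ is_basis (oapp w v),
      forall i, bracket v (w i) = w i.+1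
    & forall j k, bracket (w j) (w k) = 0].

Section Grading.
Variables (F : fieldType) (L : lieAlgType F) (G : groupType).

Definition is_subspace (U : set L) : Prop :=
  U 0 /\ forall (a : F) x y, U x -> U y -> U (a *: x + y).

Definition is_direct_sum (V : G -> set L) : Prop :=
  (forall u, exists (s : {fset G}) (f : G -> L),
     (forall g, V g (f g)) /\ u = \sum_(g <- s) f g) /\
  (forall (s : {fset G}) (f : G -> L), (forall g, V g (f g)) ->
     \sum_(g <- s) f g = 0 -> forall g, g \in s -> f g = 0).

Definition is_grading (V : G -> set L) : Prop :=
  [/\ forall g, is_subspace (V g),
      is_direct_sum V
    & forall g h x y, V g x -> V h y -> V (g * h)%g (bracket x y)].

Definition grading_support (V : G -> set L) : set G :=
  [set g | V g <> [set 0]].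

End Grading.

Section ArithmeticallyFree.
Variable G : groupType.

Definition progression (x g : G) : set G := [set (x * g ^+ n)%g | n in setT].

(* Meant for sets of pairwise commuting elements, that is, for subsets of an
   abelian subgroup, whose operation is the restriction of that of [G]. *)
Definition abelian_arithmetically_free (Z : set G) : Prop :=
  finite_set Z /\
  forall x g, Z x -> Z g -> ~ (progression x g `<=` Z).

Definition arithmetically_free (X : set G) : Prop :=
  finite_set X /\
  forall Z : set G, Z `<=` X -> (forall x y, Z x -> Z y -> commute x y) ->
    abelian_arithmetically_free Z.

End ArithmeticallyFree.

(* A model of the standard filiform Lie algebra: v = (1, 0),
   w_(i+1) = (0, 'X^i), and ad v acts on polynomials as multiplication
   by 'X. *)
Definition filiform (F : fieldType) : Type := (F^o * {poly F})%type.

HB.instance Definition _ (F : fieldType) :=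
  GRing.Lmodule.copy (filiform F) (F^o * {poly F})%type.

Section Filiform.
Variable F : fieldType.

Definition filiform_bracket (x y : filiform F) : filiform F :=
  (0, 'X * ((x.1 : F)%:P * y.2 - (y.1 : F)%:P * x.2)).

Lemma filiform_bracket_bilinear : bilinear_for *:%R *:%R filiform_bracket.
Proof.
split=> [[c r]|[c r]] k [a p] [b q]; apply: injective_projections;
  rewrite /= ?scaler0 ?addr0 //;
  by rewrite /= polyCD polyCM -!mul_polyC; ring.
Qed.

Lemma filiform_bracket_alternating x : filiform_bracket x x = 0.
Proof. by rewrite /filiform_bracket subrr mulr0. Qed.

Lemma filiform_bracket_jacobi x y z :
  filiform_bracket x (filiform_bracket y z)
    + filiform_bracket y (filiform_bracket z x)
    + filiform_bracket z (filiform_bracket x y) = 0.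
Proof.
apply: injective_projections; first by rewrite /= !addr0.
by rewrite /= polyC0; ring.
Qed.

HB.instance Definition _ := isLieAlgebra.Build F (filiform F)
  filiform_bracket_bilinear filiform_bracket_alternating filiform_bracket_jacobi.

Lemma filiform_standard :
  is_standard_filiform ((1, 0) : filiform F) (fun i => (0, 'X^i)).
Proof.
have sumE (s : {fset option nat}) (a : option nat -> F) :
    \sum_(i <- s) a i *: (oapp (fun i => (0, 'X^i)) (1, 0) i : filiform F) =
    (\sum_(i <- s) a i * (i == None)%:R,
     \sum_(i <- s) oapp (fun n => a (Some n) *: 'X^n) 0 i).
  elim/big_rec3: _ => [//|[n|] y1 y2 y3 _ ->] /=.
    by apply: injective_projections; rewrite /= ?scaler0 ?mulr0.
  by apply: injective_projections; rewrite /= ?scaler0.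
split.
- split=> [s a|[c p]].
    rewrite sumE => -[s1 s2] [n|] si.
      have := congr1 (fun p : {poly F} => p`_n) s2.
      rewrite coef0 coef_sum (big_fsetD1 _ si) /= coefZ coefXn eqxx mulr1.
      rewrite big_seq big1 ?addr0// => -[m|]; rewrite in_fsetD1 /= ?coef0//.
      case/andP=> mn _; rewrite coefZ coefXn.
      by rewrite eq_sym (_ : (m == n) = false) ?mulr0 //; apply: negbTE mn.
    move: s1; rewrite (big_fsetD1 _ si) /= mulr1.
    rewrite big_seq big1 ?addr0// => -[m|]; rewrite in_fsetD1 ?eqxx//= => _.
    by rewrite mulr0.
  pose t := None :: [seq Some n | n <- iota 0 (size p)].
  have tU : uniq t.
    rewrite /= map_inj_uniq ?iota_uniq ?andbT; last by move=> ? ? [].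
    by apply/mapP => -[].
  have tP : perm_eq [fset i in t]%fset t.
    by apply: uniq_perm => // i; rewrite in_fset.
  exists [fset i in t]%fset, (oapp (fun n => p`_n) c).
  rewrite sumE !(perm_big _ tP) !big_cons !big_map /= mulr1 add0r.
  rewrite big1 ?addr0; last by move=> *; rewrite mulr0.
  by congr pair; rewrite -[LHS]coefK poly_def -[in RHS](subn0 (size p)) -/(index_iota _ _) big_mkord.
- move=> i; apply: injective_projections => //=.
  by rewrite polyC0 polyC1 mul0r subr0 mul1r -exprS.
- move=> j k; apply: injective_projections => //=.
  by rewrite polyC0 !mul0r subr0 mulr0.
Qed.

End Filiform.

(* Main.v *)
(* If [x] and [g] commute and every [x * g ^+ n] lies in [X], giving [v] the
   degree [g] and [w n] the degree [x * g ^+ n] is a grading with support in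
   [X]. Conversely, some homogeneous component [u] of [v] has a nonzero
   [v]-coordinate, and then [ad u] acts injectively on the span of the [w i],
   which contains all brackets. Hence a homogeneous [y] with [bracket u y]
   nonzero is never killed by the iterates of [ad u], and their degrees form a
   progression inside the support. *)

From HB Require Import structures.
Require Import Defs.
From mathcomp Require Import all_boot all_order all_algebra.
From mathcomp Require Import sesquilinear finmap ring.
From mathcomp Require Import boolp classical_sets cardinality.

Set Implicit Arguments.
Unset Strict Implicit.
Unset Printing Implicit Defensive.

Import GRing.Theory.

Local Open Scope classical_set_scope.
Local Open Scope ring_scope.

(** * Coordinates with respect to a possibly infinite basis *)

Section Coordinates.
Variables (F : fieldType) (L : lmodType F) (I : choiceType) (b : I -> L).

(** Requiring [a] to vanish outside [s] makes [a] depend on [u] alone and not on the chosen finite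
    set. *)
Definition expansion (u : L) (a : I -> F) : Prop :=
  exists2 s : {fset I}, (forall i, i \notin s -> a i = 0)
    & u = \sum_(i <- s) a i *: b i.

Lemma expansion_widen (s t : {fset I}) (a : I -> F) : (s `<=` t)%fset ->
  (forall i, i \notin s -> a i = 0) ->
  \sum_(i <- s) a i *: b i = \sum_(i <- t) a i *: b i.
Proof.
by move=> st a0; apply: big_fset_incl => // i _ /a0 ->; rewrite scale0r.
Qed.

Lemma expansion_linear k u u' a a' : expansion u a -> expansion u' a' ->
  expansion (k *: u + u') (fun i => k * a i + a' i).
Proof.
move=> [s a0 ->] [t a'0 ->]; exists (s `|` t)%fset => [i|].
  by rewrite in_fsetU => /norP[/a0 -> /a'0 ->]; rewrite mulr0 addr0.
rewrite (expansion_widen (fsubsetUl s t)) //.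
rewrite (expansion_widen (fsubsetUr s t)) // scaler_sumr -big_split /=.
by apply: eq_bigr => i _; rewrite scalerDl scalerA.
Qed.

Hypothesis bP : is_basis b.

Lemma expansion_uniq u a a' : expansion u a -> expansion u a' -> a =1 a'.
Proof.
move=> ua ua'.
(* The difference of the two expansions expands 0, so freeness kills it on [s], and it vanishes
   elsewhere by definition. *)
have [s d0 /esym dE] := expansion_linear (-1) ua ua'.
rewrite scaleN1r addNr in dE.
move=> i; have d_i : -1 * a i + a' i = 0.
  by have [/(bP.1 _ _ dE)|/d0] := boolP (i \in s).
by apply/esym/eqP; rewrite -subr_eq0 addrC -mulN1r d_i.
Qed.

Lemma expansion_exists u : exists a, expansion u a.
Proof.
have [s [a ->]] := bP.2 u.
exists (fun i => if i \in s then a i else 0), s => [i /negbTE -> //|].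
by rewrite big_seq [RHS]big_seq; apply: eq_bigr => i ->.
Qed.

Definition coord (i : I) (u : L) : F := projT1 (cid (expansion_exists u)) i.

Lemma coord_expansion u : expansion u (coord^~ u).
Proof. exact: projT2 (cid (expansion_exists u)). Qed.

Lemma coord_is_scalar i : scalar (coord i).
Proof.
move=> k u u'.
have uu' := expansion_linear k (coord_expansion u) (coord_expansion u').
exact: (expansion_uniq (coord_expansion _) uu' i).
Qed.

HB.instance Definition _ i :=
  GRing.isLinear.Build F L F *%R (coord i) (coord_is_scalar i).

Lemma coord_basis i j : coord i (b j) = (i == j)%:R.
Proof.
have bj : expansion (b j) (fun k => (k == j)%:R).
  exists [fset j]%fset => [k|]; first by rewrite in_fset1 => /negbTE ->.
  by rewrite big_seq_fset1 eqxx scale1r.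
exact: (expansion_uniq (coord_expansion _) bj i).
Qed.

Lemma coord_eq0 u : (forall i, coord i u = 0) -> u = 0.
Proof.
move=> u0; have [s _ ->] := coord_expansion u.
by rewrite big1 // => i _; rewrite u0 scale0r.
Qed.

Lemma basis_ind (P : L -> Prop) : P 0 ->
  (forall a i u, P u -> P (a *: b i + u)) -> forall u, P u.
Proof.
move=> P0 PS u; have [s _ ->] := coord_expansion u.
by elim/big_rec: _ => // i x _; apply: PS.
Qed.

End Coordinates.

(** * Decompositions obtained by giving each basis vector a degree *)

Section Degree.
Variables (F : fieldType) (L : lieAlgType F) (I : choiceType) (b : I -> L).
Hypothesis bP : is_basis b.
Variables (G : groupType) (deg : I -> G).
Local Notation coord := (coord bP).

(** This is the span of the basis vectors of degree [g], described by vanishing coordinates so that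
    membership needs no choice of a linear combination. *)
Definition degree_component (g : G) : set L :=
  [set u | forall i, deg i <> g -> coord i u = 0].

Lemma degree_component_subspace g : is_subspace (degree_component g).
Proof.
split=> [i _|a x y xg yg i ig]; first by rewrite linear0.
by rewrite linearP /= xg // yg // mulr0 addr0.
Qed.

Lemma degree_component_basis i : degree_component (deg i) (b i).
Proof. by move=> j ij; rewrite coord_basis; case: eqP ij => // ->. Qed.

Lemma degree_component_sum g (s : seq I) (P : pred I) (E : I -> L) :
  (forall i, P i -> degree_component g (E i)) ->
  degree_component g (\sum_(i <- s | P i) E i).
Proof.
move=> Eg i ig; rewrite linear_sum big1 // => j Pj; exact: Eg.
Qed.

Lemma degree_componentZ g a u :
  degree_component g u -> degree_component g (a *: u).
Proof. by move=> ug i ig; rewrite linearZ /= ug // mulr0. Qed.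

Lemma degree_component_direct_sum : is_direct_sum degree_component.
Proof.
split=> [u|s f fV f0 g gs].
  have [s _ uE] := coord_expansion bP u.
  (* The terms of the expansion of [u] are grouped by degree. *)
  exists [fset deg i | i in s]%fset,
    (fun g => \sum_(i <- s | deg i == g) coord i u *: b i); split=> [g|].
    apply: degree_component_sum => i /eqP <-.
    exact/degree_componentZ/degree_component_basis.
  by rewrite {1}uE; apply: (partition_big_imfset _ deg s).
(* If [i] has degree [g], only [f g] contributes to the [i]-th coordinate of the sum; otherwise that
   coordinate of [f g] is zero already. *)
apply: (coord_eq0 (bP := bP)) => i; have [ig|/eqP ig] := eqVneq (deg i) g; last exact: fV.
have := congr1 (coord i) f0; rewrite linear0 linear_sum (big_fsetD1 _ gs) /=.
rewrite big_seq big1 ?addr0 // => h; rewrite in_fsetD1 => /andP[/eqP hg _].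
by apply: fV; rewrite ig => /esym.
Qed.

Lemma degree_component_expansion g u : degree_component g u ->
  exists s : {fset I}, u = \sum_(i <- s | deg i == g) coord i u *: b i.
Proof.
move=> ug; have [s _ uE] := coord_expansion bP u; exists s.
rewrite {1}uE [RHS]big_mkcond; apply: eq_bigr => i _.
by case: eqP => // /ug ->; rewrite scale0r.
Qed.

Lemma degree_component_neq0 g :
  degree_component g <> [set 0] -> exists i, deg i = g.
Proof.
move=> gN0; apply: contrapT => noi; apply: gN0; apply/seteqP; split=> u /=.
  by move=> ug; apply: (coord_eq0 (bP := bP)) => i; apply: ug => ig; apply: noi; exists i.
by move=> ->; apply: (degree_component_subspace g).1.
Qed.

End Degree.

(** * Lie brackets and general properties of gradings *)

HB.instance Definition _ (F : fieldType) (L : lieAlgType F) :=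
  bilinear_isBilinear.Build F L L L *:%R *:%R (@bracket F L)
    (@bracket_bilinear F L).

HB.instance Definition _ (F : fieldType) (L : lieAlgType F) (x : L) :=
  GRing.isLinear.Build F L L *:%R (bracket x) ((@bracket_bilinear F L).2 x).

Section Lie.
Variables (F : fieldType) (L : lieAlgType F).

Lemma bracketC (x y : L) : bracket x y = - bracket y x.
Proof.
have := bracket_alternating (x + y).
rewrite linearDl /= !linearDr /= !bracket_alternating add0r addr0.
by move/eqP; rewrite addr_eq0 => /eqP.
Qed.

(** By bilinearity, compatibility with the bracket has to be checked on basis vectors only. *)
Lemma degree_component_grading (I : choiceType) (b : I -> L)
    (bP : is_basis b) (G : groupType) (deg : I -> G) :
  (forall i j, degree_component bP deg (deg i * deg j)%g
     (bracket (b i) (b j))) ->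
  is_grading (degree_component bP deg).
Proof.
move=> bV; split=> [g||g h x y xg yh].
- exact: degree_component_subspace.
- exact: degree_component_direct_sum.
have [s ->] := degree_component_expansion xg.
have [t ->] := degree_component_expansion yh.
rewrite linear_sumlz; apply: degree_component_sum => i /eqP <-.
rewrite linear_sumr; apply: degree_component_sum => j /eqP <-.
rewrite linearZl_LR linearZr_LR /=.
by do 2!apply: degree_componentZ.
Qed.

Lemma grading_opp (G : groupType) (V : G -> set L) g x :
  is_grading V -> V g x -> V g (- x).
Proof.
by move=> [Vs _ _] xg; rewrite -[- x]addr0 -scaleN1r; apply: (Vs g).2 => //;
  apply: (Vs g).1.
Qed.

Lemma grading_degree_uniq (G : groupType) (V : G -> set L) g h x :
  is_grading V -> V g x -> V h x -> x <> 0 -> g = h.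
Proof.
move=> gV xg xh x0; apply: contrapT => /eqP gh; apply: x0.
have [Vs [_ VI] _] := gV.
(* If [g] and [h] differ, [x] in degree [g] and [- x] in degree [h] sum to 0, against directness. *)
pose f k : L := if k == g then x else if k == h then - x else 0.
have fV k : V k (f k).
  rewrite /f; case: eqP => [-> //|_]; case: eqP => [->|_].
    exact: grading_opp.
  exact: (Vs k).1.
have := VI [fset g; h]%fset f fV; rewrite big_fsetU1 ?in_fset1 //=.
rewrite big_seq_fset1 /f eqxx [h == g]eq_sym (negbTE gh) eqxx subrr.
by move=> /(_ erefl g); rewrite eqxx !inE eqxx => /(_ isT).
Qed.

Lemma grading_support_mem (G : groupType) (V : G -> set L) g x :
  V g x -> x <> 0 -> grading_support V g.
Proof. by move=> xg x0 Vg; apply: x0; rewrite Vg in xg. Qed.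

(** An additive map that kills every homogeneous element kills all their sums. This is applied below
    to the coordinate along [v] and to [bracket u]. *)
Lemma grading_component_notin_ker (G : groupType) (V : G -> set L)
    (W : zmodType) (f : {additive L -> W}) u :
  is_grading V -> f u <> 0 -> exists g x, V g x /\ f x <> 0.
Proof.
move=> [_ [/(_ u)[s [e [eV ->]]] _] _] fu; apply: contrapT => no.
apply: fu; rewrite raddf_sum big1 // => g _; apply: contrapT => fg.
by apply: no; exists g, (e g).
Qed.

End Lie.

(** * Gradings of the standard filiform algebra *)

Section Filiform.
Variables (F : fieldType) (L : lieAlgType F) (v : L) (w : nat -> L).
Hypothesis vwP : is_standard_filiform v w.

Let bP : is_basis (oapp w v). Proof. by case: vwP. Qed.
Local Notation c := (coord bP).

Lemma coord_bracket k x y : c k (bracket x y) =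
  if k is Some i.+1 then c None x * c (Some i) y - c None y * c (Some i) x
  else 0.
Proof.
have [_ vw ww] := vwP.
elim/(basis_ind bP): x => [|a p x IHx].
  rewrite linear0l linear0.
  by case: k => [[|i]|]; rewrite ?linear0 ?mul0r ?mulr0 ?subr0.
rewrite linearPl linearP /= {}IHx.
(* Both sides are bilinear, so [x], and then [y], may be taken to be a basis vector. *)
suff -> : c k (bracket (oapp w v p) y) =
    if k is Some i.+1 then
      (p == None)%:R * c (Some i) y - c None y * (p == Some i)%:R
    else 0.
  case: k => [[|i]|]; rewrite ?mulr0 ?addr0 // !linearP /=.
  by rewrite !(coord_basis bP _ p) ![_ == p]eq_sym; ring.
elim/(basis_ind bP): y => [|d q y IHy].
  rewrite linear0r linear0.
  by case: k => [[|i]|]; rewrite ?linear0 ?mul0r ?mulr0 ?subr0.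
rewrite linearPr linearP /= {}IHy.
suff -> : c k (bracket (oapp w v p) (oapp w v q)) =
    if k is Some i.+1 then
      (p == None)%:R * (q == Some i)%:R - (q == None)%:R * (p == Some i)%:R
    else 0.
  case: k => [[|i]|]; rewrite ?mulr0 ?addr0 // !linearP /=.
  by rewrite !(coord_basis bP _ q) ![_ == q]eq_sym; ring.
have cw j : c k (w j.+1) = if k is Some i.+1 then (j == i)%:R else 0.
  rewrite (coord_basis bP k (Some j.+1)) eq_sym.
  by case: k => [[|i]|].
case: p q => [j|] [l|] /=; rewrite ?ww ?bracket_alternating ?linear0.
- by case: k {cw} => [[|i]|]; rewrite ?mul0r ?subr0.
- rewrite bracketC vw linearN /= cw.
  by case: k {cw} => [[|i]|]; rewrite ?oppr0 ?mul0r ?mul1r ?sub0r.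
- rewrite vw cw.
  by case: k {cw} => [[|i]|]; rewrite ?mul0r ?mul1r ?subr0.
by case: k {cw} => [[|i]|]; rewrite ?mulr0 ?subr0.
Qed.

(** When [y] has no [v]-part, bracketing with [u] shifts its coordinates by one and scales them by
    the nonzero [v]-coordinate of [u]. *)
Lemma bracket_neq0 u y :
  c None u != 0 -> c None y = 0 -> y <> 0 -> bracket u y <> 0.
Proof.
move=> u0 y0 yN uy; apply: yN; apply: (coord_eq0 (bP := bP)) => -[i|//].
have := coord_bracket (Some i.+1) u y.
rewrite uy linear0 y0 mul0r subr0 => /esym/eqP.
by rewrite mulf_eq0 (negbTE u0) => /eqP.
Qed.

Lemma iter_bracket_neq0 u y n : c None u != 0 -> bracket u y <> 0 ->
  iter n (bracket u) y <> 0.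
Proof.
(* The vector [y] may have a [v]-part, so the induction starts at [bracket u y], which like every
   bracket has none. *)
move=> u0 uy; case: n => [/= y0|n]; first by apply: uy; rewrite y0 linear0r.
elim: n => // n IH; apply: bracket_neq0 => //.
exact: coord_bracket None _ _.
Qed.

(* [bracket u y] lies in both [V (g * x)] and [V (x * g)], whence [g] and [x]
   commute although [G] is not assumed abelian. *)
Lemma grading_progression (G : groupType) (V : G -> set L) : is_grading V ->
  exists x g, [/\ commute x g, grading_support V g
    & progression x g `<=` grading_support V].
Proof.
move=> gV; have [_ _ Vbr] := gV; have [_ vw _] := vwP.
have cv : c None v <> 0.
  rewrite (coord_basis bP None None) eqxx; exact/eqP/oner_neq0.
have [g [u [ug /eqP u0]]] := grading_component_notin_ker (f := c None) gV cv.
(* The coordinate of this bracket along [w 1] is the [v]-coordinate of [u]. *)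
have uw : bracket u (w 0%N) <> 0.
  move=> /(congr1 (c (Some 1%N))); rewrite linear0 coord_bracket.
  rewrite (coord_basis bP (Some 0%N) (Some 0%N)).
  rewrite (coord_basis bP None (Some 0%N)) mulr1 mul0r subr0.
  exact/eqP.
have [x [y [yx uy]]] := grading_component_notin_ker (f := bracket u) gV uw.
have xg : commute x g.
  apply/esym; apply: (grading_degree_uniq gV _ _ uy); first exact: Vbr.
  by rewrite /= bracketC; apply: grading_opp => //; apply: Vbr.
exists x, g; split=> // [|_ [n _ <-]].
  apply: (grading_support_mem ug) => u_eq0.
  by move: u0; rewrite u_eq0 raddf0 eqxx.
apply: (grading_support_mem _ (iter_bracket_neq0 (n := n) u0 uy)).
elim: n => [|n IH]; first by rewrite mulg1.
(* Bracketing with [u] multiplies the degree by [g] on the left; commutation turns this into the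
   next term of the progression. *)
rewrite expgS mulgA xg -mulgA; exact: Vbr.
Qed.

Definition filiform_degree (G : groupType) (x g : G) (i : option nat) : G :=
  if i is Some n then (x * g ^+ n)%g else g.

(** Commutation enters for [bracket v (w j)], whose degree [g * (x * g ^+ j)] has to equal
    [x * g ^+ j.+1]. *)
Lemma filiform_degree_grading (G : groupType) (x g : G) : commute x g ->
  is_grading (degree_component bP (filiform_degree x g)).
Proof.
move=> xg; have [_ vw ww] := vwP.
have V0 h : degree_component bP (filiform_degree x g) h 0.
  exact: (degree_component_subspace _ _ _).1.
have Vw n := @degree_component_basis _ _ _ _ bP _ (filiform_degree x g) (Some n).
apply: degree_component_grading => -[i|] [j|] /=.
- by rewrite ww.
- rewrite bracketC vw -mulgA -expgSr -scaleN1r.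
  exact: degree_componentZ (Vw i.+1).
- by rewrite vw mulgA -xg -mulgA -expgS; apply: (Vw j.+1).
- by rewrite bracket_alternating.
Qed.

End Filiform.

(** * Translation between gradings and progressions in [X] *)

Unset Implicit Arguments.
Theorem mainTheorem4 (F : fieldType) (L : lieAlgType F) (v : L) (w : nat -> L)
    (hL : is_standard_filiform v w) (G : groupType) (X : set G)
    (hX : finite_set X) :
  arithmetically_free X <->
  ~ (exists V : G -> set L, is_grading V /\ grading_support V `<=` X).
Proof.
split=> [[_ Xfree] [V [gV VX]]|noV].
  have [x [g [xg Vg Vxg]]] := grading_progression hL gV.
  (* The step [g] is adjoined because arithmetic freeness of [Z] only concerns steps lying in
     [Z]. *)
  pose Z := g |` progression x g.
  have gxn n : commute g (x * g ^+ n)%g.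
    by apply: commuteM; [apply: commute_sym | apply: commuteX].
  have ZX : Z `<=` X by move=> y [->|/Vxg yV]; apply: VX.
  have Zcomm y z : Z y -> Z z -> commute y z.
    move=> Zy Zz; have gz : commute g z by case: Zz => [->|[n _ <-]].
    have xz : commute x z.
      by case: Zz => [->|[n _ <-]] //; apply: commuteM => //; apply: commuteX.
    case: Zy => [-> //|[n _ <-]]; apply/commute_sym/commuteM.
      exact: commute_sym.
    exact/commuteX/commute_sym.
  have [_ Zfree] := Xfree Z ZX Zcomm.
  apply: (Zfree x g); first by right; exists 0%N; rewrite ?mulg1.
    by left.
  by move=> y; right.
split=> // Z ZX Zcomm; split=> [|x g Zx Zg xgZ].
  exact: sub_finite_set hX.
(* A progression inside [Z] yields a grading whose support consists of degrees of basis vectors: [g]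
   and the terms [x * g ^+ n], all in [Z]. *)
apply: noV; eexists; split.
  exact: (filiform_degree_grading hL (Zcomm _ _ Zx Zg)).
move=> h /degree_component_neq0[[n|] <-]; apply: ZX => //.
by apply: xgZ; exists n.
Qed.
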